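(* Let $s\ge 2$ and consider anisotropic bond percolation on $\mathbb{Z}\times\mathbb{Z}^s$ with parameters $(p,q)$. There exist $\alpha>0$ and $p_0<1$ with the following property. If $p\in(p_0,1)$ and $$q>\alpha\,\frac{1-p}{1+p},$$ then $\mathbb{P}_{p,q}$-almost surely there is an infinite open cluster in $\mathbb{Z}^{1+s}$; in particular $\theta(p,q)>0$.
   Context: $\mathbb{Z}^{1+s}=\mathbb{Z}\times\mathbb{Z}^s$ is the nearest-neighbour graph on $\mathbb{Z}^{1+s}$. An edge is a $\mathbb{Z}$-edge if its two endpoints differ only in their first ($\mathbb{Z}$) coordinate, and a $\mathbb{Z}^s$-edge if they differ only in their $\mathbb{Z}^s$ component. Under $\mathbb{P}_{p,q}$ each $\mathbb{Z}$-edge is open with probability $p$ and each $\mathbb{Z}^s$-edge is open with probability $q$, independently of all other edges. $\theta(p,q)$ is the $\mathbb{P}_{p,q}$-probability that the open cluster of the origin is infinite. *)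

(* Defs.v *)
From HB Require Import structures.
From mathcomp Require Import all_boot all_order all_algebra.
From mathcomp Require Import all_classical all_reals all_analysis.
From Stdlib Require Import Relations.
Set Implicit Arguments. Unset Strict Implicit. Unset Printing Implicit Defensive.
Import Order.TTheory GRing.Theory Num.Theory.
Local Open Scope classical_set_scope.
Local Open Scope ring_scope.

(* Vertices of Z^{1+s} = Z x Z^s: functions 'I_(s.+1) -> int; coordinate
   ord0 is the Z coordinate, coordinates 1..s form the Z^s component. *)
Definition vtx (s : nat) := {ffun 'I_s.+1 -> int}.

Definition shift (s : nat) (x : vtx s) (i : 'I_s.+1) : vtx s :=
  [ffun j => x j + ((j == i) : nat)%:Z].

(* Nearest-neighbour edges: (x, i) is the edge {x, x + e_i}.  Every
   nearest-neighbour edge has exactly one such representation. *)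
Definition edge (s : nat) := (vtx s * 'I_s.+1)%type.

Definition is_Zedge (s : nat) (e : edge s) : bool := e.2 == ord0.

Definition open_adj (s : nat) (w : edge s -> bool) (x y : vtx s) : Prop :=
  exists i : 'I_s.+1,
    (y = shift x i /\ w (x, i)) \/ (x = shift y i /\ w (y, i)).

Definition cluster (s : nat) (w : edge s -> bool) (x : vtx s) : set (vtx s) :=
  [set y | clos_refl_trans _ (open_adj w) x y].

Definition origin (s : nat) : vtx s := [ffun => 0%:Z].

(* A family of events A e (e = "edge e is open") realizes the percolation
   measure P_{p,q}: the events are mutually independent, Z-edges open with
   probability p, Z^s-edges open with probability q. *)
Definition bond_percolation (R : realType) (s : nat) (d : measure_display)
  (T : measurableType d) (P : probability T R) (A : edge s -> set T)
  (p q : R) : Prop :=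
  (forall e, measurable (A e)) /\
  forall F : seq (edge s), uniq F ->
    P [set t | forall e, e \in F -> A e t] =
    (\prod_(e <- F) (if is_Zedge e then p else q))%:E.

Definition config (s : nat) (d : measure_display) (T : measurableType d)
  (A : edge s -> set T) (t : T) : edge s -> bool :=
  fun e => `[< A e t >].

Definition infinite_cluster_exists (s : nat) (d : measure_display)
  (T : measurableType d) (A : edge s -> set T) : set T :=
  [set t | exists x : vtx s, ~ finite_set (cluster (config A t) x)].

Definition origin_cluster_infinite (s : nat) (d : measure_display)
  (T : measurableType d) (A : edge s -> set T) : set T :=
  [set t | ~ finite_set (cluster (config A t) (origin s))].

(* Main.v *)
(* Only the plane spanned by the Z-axis and one Z^s-axis is used, and no planar
   duality.  Cut each line parallel to the Z-axis into segments of length N,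
   with N (1 - p) small but N q large.  With probability close to 1 a segment is
   entirely open and joined by an open edge to the next parallel segment; call
   it a good block of level 0.  A block of level k + 1 is a 3 x 3 array of
   blocks of level k and is good if at most one of them is bad.  By induction
   the good parts of neighbouring good blocks are connected to each other, and
   since a bad block contains two disjoint bad subblocks, the probability of
   being bad at level k is at most 2^-k / 200.  Hence almost surely all the
   blocks at the origin of large enough level are good, which gives an infinite
   cluster, and with positive probability this holds from level 0 on. *)
Require Import Defs.
From HB Require Import structures.
From mathcomp Require Import all_boot all_order all_algebra.
From mathcomp Require Import all_classical all_reals all_analysis.
From mathcomp Require Import zify ring lra.
From Stdlib Require Import Relations.
Import Order.TTheory GRing.Theory Num.Theory.
Local Open Scope classical_set_scope.
Local Open Scope ring_scope.

(** * Connectivity of the 3 x 3 grid with one cell removed *)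

Section Grid.
Local Open Scope nat_scope.

Definition cells : seq (nat * nat) := [seq (i, j) | i <- iota 0 3, j <- iota 0 3].

Definition step (z z' : nat * nat) : bool :=
  (z' == (z.1.+1, z.2)) || (z' == (z.1, z.2.+1)).

(** One round of graph search avoiding [e]; iterating it computes a component of the punctured
    grid. *)
Definition expand (e : nat * nat) (l : seq (nat * nat)) : seq (nat * nat) :=
  l ++ [seq c <- cells | (c != e) && has (fun c0 => step c0 c || step c c0) l].

(** Eight cells remain, so eight rounds of search exhaust a component. That there is only one
    component is a finite computation over [e] and the starting cell. *)
Lemma expand_grid_full : all (fun e => all (fun c => (c == e) ||
  all (fun c' => (c' == e) || (c' \in iter 8 (expand e) [:: c])) cells) cells)
  cells.
Proof. by vm_compute. Qed.

Lemma cell_neighbour : all (fun c => has (fun c' =>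
  (c' != c) && (step c c' || step c' c)) cells) cells.
Proof. by vm_compute. Qed.

(** [Q] will be the linkage of subblocks. Transitivity is demanded only through cells other than
    [e], because linkage composes only through a block known to be good. *)
Lemma punctured_grid_connected (e : nat * nat)
    (Q : nat * nat -> nat * nat -> Prop) :
    let V c := c \in cells /\ c != e in
    e \in cells ->
    (forall c, V c -> Q c c) ->
    (forall c c' c'', V c -> V c' -> V c'' -> Q c c' -> Q c' c'' -> Q c c'') ->
    (forall c c', V c -> V c' -> Q c c' -> Q c' c) ->
    (forall c c', V c -> V c' -> step c c' -> Q c c') ->
  forall c c', V c -> V c' -> Q c c'.
Proof.
move=> V ec Qr Qt Qs Qstep.
have key n c c' : V c -> c' \in iter n (expand e) [:: c] -> V c' /\ Q c c'.
  elim: n c' => [|n IH] c' Vc /=.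
    by rewrite inE => /eqP ->; split => //; exact: Qr.
  rewrite mem_cat => /orP[/(IH _ Vc)//|].
  rewrite mem_filter => /andP[/andP[ne /hasP[c0 /(IH _ Vc)[Vc0 Q0] st]] cc].
  have Vc' : V c' by [].
  split => //; apply: Qt Q0 _ => //.
  by case/orP: st => st; [exact: Qstep|apply: Qs => //; exact: Qstep].
move=> c c' Vc Vc'.
have /allP /(_ e ec) /allP /(_ c Vc.1) := expand_grid_full.
rewrite (negPf Vc.2) => /allP /(_ c' Vc'.1); rewrite (negPf Vc'.2).
by case/(key _ _ _ Vc).
Qed.

End Grid.

(** * The quadrant spanned by the Z-axis and one Z^s-axis, with natural-number coordinates *)

Definition plane (s u v : nat) : vtx s :=
  [ffun i => if i == ord0 then u%:Z else if i == inord 1 then v%:Z else 0].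

Lemma origin_plane (s : nat) : origin s = plane s 0 0.
Proof. by apply/ffunP => i; rewrite !ffunE; case: ifP => // _; case: ifP. Qed.

Lemma shift_plane0 (s u v : nat) : Defs.shift (plane s u v) ord0 = plane s u.+1 v.
Proof.
apply/ffunP => i; rewrite !ffunE; case: eqP => //= _; last by rewrite addr0.
by rewrite -PoszD addn1.
Qed.

Lemma inord1_neq0 (s : nat) : (0 < s)%N -> (inord 1 : 'I_s.+1) != ord0.
Proof. by move=> s0; rewrite -val_eqE /= inordK. Qed.

Lemma shift_plane1 (s u v : nat) : (0 < s)%N ->
  Defs.shift (plane s u v) (inord 1) = plane s u v.+1.
Proof.
move=> s0; apply/ffunP => i; rewrite !ffunE.
have [->|_] := eqVneq i ord0; first by rewrite eq_sym (negPf (inord1_neq0 s s0)) addr0.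
by case: eqP => //= _; rewrite -PoszD addn1.
Qed.

Lemma plane_inj (s u v u' v' : nat) : (0 < s)%N ->
  plane s u v = plane s u' v' -> u = u' /\ v = v'.
Proof.
move=> s0 /ffunP h; have := h ord0; have := h (inord 1).
by rewrite !ffunE /= ?eqxx (negPf (inord1_neq0 s s0)) => -[->] [->].
Qed.

(** * Deterministic renormalization: the good parts of neighbouring good blocks are connected *)

Section Connectivity.
Variables (s : nat) (w : edge s -> bool).

Definition reach := clos_refl_trans _ (open_adj w).

Lemma reach_sym x y : reach x y -> reach y x.
Proof.
elim=> [a b [i h]|a|a b c _ ab _ bc].
- by apply: rt_step; exists i; case: h; [right|left].
- exact: rt_refl.
- exact: rt_trans bc ab.
Qed.

Variables (N : nat).
Hypotheses (s0 : (0 < s)%N) (N0 : (0 < N)%N).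

Definition sub (z c : nat * nat) : nat * nat := (3 * z.1 + c.1, 3 * z.2 + c.2)%N.

(** At level 0 the Z-edge at [j = N - 1] leaves the segment and ends at the first vertex of the next
    one. At higher levels nothing is asked of the subblock at [e], which may itself be good. *)
Fixpoint good (k : nat) (z : nat * nat) : Prop :=
  if k is k'.+1 then
    exists2 e, e \in cells & forall c, c \in cells -> c != e -> good k' (sub z c)
  else (forall j, (j < N)%N -> w (plane s (z.1 * N + j) z.2, ord0)) /\
       (exists2 j, (j < N)%N & w (plane s (z.1 * N + j) z.2, inord 1)).

(** The good part of a block. Every good subblock contributes, even the exceptional one, so a core
    vertex of a good subblock is a core vertex of the block; [cluster_infinite] relies on this. *)
Fixpoint core (k : nat) (z : nat * nat) (x : vtx s) : Prop :=
  if k is k'.+1 then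
    exists c, [/\ c \in cells, good k' (sub z c) & core k' (sub z c) x]
  else exists2 j, (j < N)%N & x = plane s (z.1 * N + j) z.2.

Definition linked (k : nat) (z z' : nat * nat) :=
  forall x y, core k z x -> core k z' y -> reach x y.

Lemma core_nonempty k z : good k z -> exists x, core k z x.
Proof.
elim: k z => [|k IH] z /=; first by move=> _; exists (plane s (z.1 * N + 0) z.2); exists 0%N.
move=> [e ec H].
have [c [cc ce]] : exists c, c \in cells /\ c != e.
  by have [->|h] := eqVneq e (0, 0)%N; [exists (0, 1)%N|exists (0, 0)%N; rewrite eq_sym].
by have [x hx] := IH _ (H c cc ce); exists x, c; split => //; exact: H.
Qed.

(** Linkage is vacuous on an empty core, so the middle block has to be good to supply an
    intermediate vertex. *)
Lemma linked_trans k z z' z'' : good k z' ->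
  linked k z z' -> linked k z' z'' -> linked k z z''.
Proof.
move=> /core_nonempty[y hy] h h' x x' hx hx'.
by apply: rt_trans (h _ _ hx hy) (h' _ _ hy hx').
Qed.

Lemma linked_sym k z z' : linked k z z' -> linked k z' z.
Proof. by move=> h x y hx hy; apply/reach_sym/h. Qed.

Lemma column_reach a b n j : (forall j, (j < n)%N -> w (plane s (a + j) b, ord0)) ->
  (j <= n)%N -> reach (plane s a b) (plane s (a + j) b).
Proof.
move=> h; elim: j => [_|j IH jn]; first by rewrite addn0; exact: rt_refl.
apply: rt_trans (IH (ltnW jn)) _; apply: rt_step; exists ord0; left.
by rewrite shift_plane0 addnS; split => //; exact: h.
Qed.

Lemma linked_core0 z : good 0 z -> linked 0 z z.
Proof.
move=> [h _] x y [j jN ->] [j' j'N ->].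
apply: (rt_trans _ _ _ (plane s (z.1 * N) z.2)).
  by apply: reach_sym; apply: (column_reach _ _ N) => //; exact: ltnW.
by apply: (column_reach _ _ N) => //; exact: ltnW.
Qed.

(** Along the Z-axis, the last Z-edge of [z] ends at the first vertex of [z']. In the other
    direction, the open transversal edge of [z] ends in [z']. *)
Lemma linked_step0 z z' : good 0 z -> good 0 z' -> step z z' -> linked 0 z z'.
Proof.
move=> gz gz' /orP[]/eqP ez'.
- move=> x y hx hy; apply: (rt_trans _ _ _ (plane s (z.1 * N + 0) z.2)).
    by apply: linked_core0 hx _ => //; exists 0%N.
  apply: (rt_trans _ _ _ (plane s (z'.1 * N + 0) z'.2)); last first.
    by apply: linked_core0 hy => //; exists 0%N.
  rewrite ez' /= addn0 addn0 mulSn addnC.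
  by apply: (column_reach _ _ N); first exact: gz.1.
- move=> x y hx hy; have [j jN wj] := gz.2.
  apply: (rt_trans _ _ _ (plane s (z.1 * N + j) z.2)).
    by apply: linked_core0 hx _ => //; exists j.
  apply: (rt_trans _ _ _ (plane s (z'.1 * N + j) z'.2)); last first.
    by apply: linked_core0 hy => //; exists j.
  by rewrite ez' /=; apply: rt_step; exists (inord 1); left; rewrite shift_plane1.
Qed.

Lemma sub_step z c c' : step c c' -> step (sub z c) (sub z c').
Proof.
by case/orP=> /eqP->; rewrite /step /sub /= addnS eqxx ?orbT.
Qed.

Lemma mem_cells c : (c \in cells) = (c.1 < 3)%N && (c.2 < 3)%N.
Proof.
by case: c => [[|[|[|i]]] [|[|[|j]]]].
Qed.

Lemma two_avoid (i i' : nat) : exists j, [/\ (j < 3)%N, j != i & j != i'].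
Proof.
have [h0|h0] := boolP ((0%N != i) && (0%N != i')); first by exists 0%N; case/andP: h0.
have [h1|h1] := boolP ((1%N != i) && (1%N != i')); first by exists 1%N; case/andP: h1.
by exists 2%N; split; lia.
Qed.

(* Two neighbouring blocks share three pairs of neighbouring subblocks, and
   their exceptional subblocks spoil at most two of these pairs. *)
Lemma linked_good k : (forall z, good k z -> linked k z z) /\
  (forall z z', good k z -> good k z' -> step z z' -> linked k z z').
Proof.
elim: k => [|k [IH1 IH2]]; first by split; [exact: linked_core0|exact: linked_step0].
have conn z : good k.+1 z -> linked k.+1 z z.
  move=> [e ec H].
  (* If the exceptional subblock is good it lies in the core and must be attached: a grid neighbour
     of it is not exceptional, hence good, and the induction hypothesis links the two. *)
  have near c : c \in cells -> good k (sub z c) -> exists c', [/\ c' \in cells,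
      c' != e & linked k (sub z c) (sub z c')].
    move=> cc gc; have [ce|ce] := eqVneq c e; last first.
      by exists c; split => //; exact: IH1.
    have /allP /(_ _ cc) /hasP[d dc /andP[de st]] := cell_neighbour.
    exists d; rewrite -ce; split => //.
    have gd : good k (sub z d) by apply: H; rewrite // -ce.
    case/orP: st => /(sub_step z) st; first exact: IH2.
    by apply: linked_sym; exact: IH2.
  have punct : forall c c', c \in cells /\ c != e -> c' \in cells /\ c' != e ->
      linked k (sub z c) (sub z c').
    apply: punctured_grid_connected => //.
    - by move=> c [cc ce]; apply: IH1; exact: H.
    - by move=> c c' c'' _ [cc' ce'] _; apply: linked_trans; exact: H.
    - by move=> c c' _ _; exact: linked_sym.
    - by move=> c c' [cc ce] [cc' ce'] /(sub_step z); apply: IH2; exact: H.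
  move=> x y [c [cc gc hx]] [c' [cc' gc' hy]].
  have [d [dc de cd]] := near c cc gc.
  have [d' [dc' de' cd']] := near c' cc' gc'.
  apply: (linked_trans _ _ _ _ (H _ dc de) cd) hx hy.
  apply: (linked_trans _ _ _ _ (H _ dc' de')); last exact: linked_sym.
  exact: punct.
split=> // z z' gz gz' st x y hx hy.
have [c [c' [cc cc' gc gc' st']]] : exists c c', [/\ c \in cells, c' \in cells,
    good k (sub z c), good k (sub z' c') & step (sub z c) (sub z' c')].
  case: gz gz' => e _ H [e' _ H'].
  case/orP: st => /eqP ez; subst z'.
  - have [j [j3 je je']] := two_avoid e.2 e'.2.
    exists (2, j)%N, (0, j)%N; rewrite !mem_cells /= j3; split => //.
    + by apply: H; rewrite ?mem_cells ?j3 //; apply: contraNneq je => <-.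
    + by apply: H'; rewrite ?mem_cells ?j3 //; apply: contraNneq je' => <-.
    + by apply/orP; left; apply/eqP; congr pair => /=; lia.
  - have [j [j3 je je']] := two_avoid e.1 e'.1.
    exists (j, 2)%N, (j, 0)%N; rewrite !mem_cells /= j3; split => //.
    + by apply: H; rewrite ?mem_cells ?j3 //; apply: contraNneq je => <-.
    + by apply: H'; rewrite ?mem_cells ?j3 //; apply: contraNneq je' => <-.
    + by apply/orP; right; apply/eqP; congr pair => /=; lia.
have [u hu] := core_nonempty _ _ gc; have [v hv] := core_nonempty _ _ gc'.
apply: (rt_trans _ _ _ u); first by apply: (conn z) => //; exists c.
apply: (rt_trans _ _ _ v); last by apply: (conn z') => //; exists c'.
exact: IH2 hu hv.
Qed.

Lemma core_coord k z x : core k z x ->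
  exists u v : nat, x = plane s u v /\ (z.1 * 3 ^ k * N <= u)%N.
Proof.
elim: k z => [|k IH] z /=.
  by move=> [j _ ->]; exists (z.1 * N + j)%N, z.2; split => //; rewrite expn0; lia.
move=> [c [_ _ /IH[u [v [-> h]]]]]; exists u, v; split => //.
apply: leq_trans h; rewrite expnS /= leq_mul2r mulnA leq_mul2r.
by apply/orP; right; apply/orP; right; lia.
Qed.

(** Some non-exceptional subblock lies off the first column, and the first coordinates in its core
    are at least [3 ^ k * N], hence at least [k]. Cores of growing level are therefore unbounded. *)
Lemma good_far k : good k.+1 (0, 0)%N ->
  exists x u v, [/\ core k.+1 (0, 0)%N x, x = plane s u v & (k <= u)%N].
Proof.
move=> [e _ H].
have [c [cc ce c1]] : exists c, [/\ c \in cells, c != e & (0 < c.1)%N].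
  have [->|h] := eqVneq e (2, 0)%N; first by exists (2, 1)%N.
  by exists (2, 0)%N; rewrite eq_sym.
have [x hx] := core_nonempty _ _ (H c cc ce).
have [u [v [ex h]]] := core_coord _ _ _ hx.
exists x, u, v; split => //; first by exists c; split => //; exact: H.
apply: leq_trans h; rewrite /= muln0 add0n.
apply: (leq_trans (ltnW (ltn_expl k (isT : 1 < 3)%N))).
by rewrite -mulnA mulnCA leq_pmulr // muln_gt0 c1.
Qed.

(** The block [(0, 0)] is the corner subblock of the block [(0, 0)] one level higher, so [x] stays
    in the core at all levels from [n] on and is linked there to arbitrarily distant vertices. *)
Lemma cluster_infinite n x : (forall k, (n <= k)%N -> good k (0, 0)%N) ->
  core n (0, 0)%N x -> ~ finite_set (Defs.cluster w x).
Proof.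
move=> H cx.
have cxk k : core (n + k) (0, 0)%N x.
  elim: k => [|k IH]; rewrite ?addn0 // addnS /=.
  by exists (0, 0)%N; split => //; apply: H; exact: leq_addr.
move=> fin.
have : finite_set ((fun y : vtx s => `|y ord0|%N) @` Defs.cluster w x).
  exact: finite_image.
move/finite_seqP => [l hl].
(* Of the two extra levels, [good_far] consumes one and the other puts the coordinate strictly above
   every element of [l]. *)
have [y [u [v [cy ey ku]]]] := good_far _ (H (n + \max_(i <- l) i).+2 ltac:(lia)).
have : (`|y ord0|%N \in l) => [|yl].
  have : ((fun y : vtx s => `|y ord0|%N) @` Defs.cluster w x) `|y ord0|%N.
    exists y => //; apply: (linked_good _).1 cy; first exact: H (leqW (leqW (leq_addr _ _))).
    by have := cxk (\max_(i <- l) i).+2; rewrite !addnS.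
  by rewrite hl.
have : (`|y ord0| <= \max_(i <- l) i)%N by exact: (leq_bigmax_seq (F := id)) yl isT.
rewrite ey ffunE eqxx /= => umax.
by have := leq_trans ku (leq_trans umax (leq_addl n _)); rewrite ltnn.
Qed.

End Connectivity.

(** * Measurability of the cluster events *)

Section Measurability.
Context (s : nat) (d : measure_display) (T : measurableType d).
Variable A : edge s -> set T.
Hypothesis mA : forall e, measurable (A e).

Lemma measurable_exists (U : countType) (F : U -> T -> Prop) :
  (forall u, measurable [set t | F u t]) -> measurable [set t | exists u, F u t].
Proof.
move=> mF; rewrite (_ : [set t | _] = \bigcup_u [set t | F u t]).
  by apply: countable_bigcupT_measurable => //; exact: countableP.
by apply/seteqP; split => [t [u h]|t [u _ h]]; exists u.
Qed.

Lemma measurable_forall (U : countType) (F : U -> T -> Prop) :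
  (forall u, measurable [set t | F u t]) -> measurable [set t | forall u, F u t].
Proof.
move=> mF; rewrite (_ : [set t | _] = ~` [set t | exists u, ~ F u t]).
  by apply/measurableC/measurable_exists => u; exact: (measurableC (mF u)).
apply/seteqP; split => [t h [u]|t /= h u]; first exact.
by apply: contrapT => nF; apply: h; exists u.
Qed.

Lemma measurable_const_and (Q : Prop) (B : set T) :
  measurable B -> measurable [set t | Q /\ B t].
Proof.
move=> mB; have [q|nq] := pselect Q.
  by rewrite (_ : [set t | _] = B) //; apply/seteqP; split => t // [].
by rewrite (_ : [set t | _] = set0) //; apply/seteqP; split => t // [].
Qed.

Lemma measurable_open_adj x y : measurable [set t | open_adj (config A t) x y].
Proof.
apply: measurable_exists => i.
have h (Q : Prop) e : measurable [set t | Q /\ config A t e].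
  rewrite (_ : [set t | _] = [set t | Q /\ A e t]); first exact: measurable_const_and.
  by apply/seteqP; split => t [q] /asboolP.
exact: (measurableU _ _ (h _ _) (h _ _)).
Qed.

(** Explicit finite paths: lists of vertices are countable, so reachability becomes a countable
    union over paths. *)
Fixpoint chain (w : edge s -> bool) (x : vtx s) (l : seq (vtx s)) (y : vtx s) :=
  if l is z :: l' then open_adj w x z /\ chain w z l' y else x = y.

Lemma reachP (w : edge s -> bool) x y : reach s w x y <-> exists l, chain w x l y.
Proof.
split=> [xy|[l]].
  elim: (clos_rt_rt1n _ _ _ _ xy) => [z|z z' z'' zz' _ [l hl]]; first by exists [::].
  by exists (z' :: l).
elim: l x => [x ->|z l IH x [xz /IH zy]]; first exact: rt_refl.
by apply: rt_trans zy; exact: rt_step.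
Qed.

Lemma measurable_reach x y : measurable [set t | reach s (config A t) x y].
Proof.
rewrite (_ : [set t | _] = [set t | exists l, chain (config A t) x l y]).
  apply: measurable_exists => l; elim: l x => [|z l IH] x /=.
    rewrite (_ : mkset _ = [set t | x = y /\ [set: T] t]); first exact: measurable_const_and.
    by apply/seteqP; split => t //= [].
  exact: (measurableI _ _ (measurable_open_adj x z) (IH z)).
by apply/seteqP; split => t /reachP.
Qed.

(** A cluster is finite exactly when some finite list contains it, which is a countable union of
    countable intersections. *)
Lemma measurable_infinite_cluster x :
  measurable [set t | ~ finite_set (Defs.cluster (config A t) x)].
Proof.
apply: (@measurableC _ _ [set t | finite_set (Defs.cluster (config A t) x)]).
rewrite (_ : [set t | _] = [set t | exists l : seq (vtx s), forall y,
    ~ ((y \notin l) /\ reach s (config A t) x y)]).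
  apply: measurable_exists => l; apply: measurable_forall => y.
  exact: (measurableC (measurable_const_and _ _ (measurable_reach x y))).
apply/seteqP; split => t /=.
  move=> /finite_seqP[l hl]; exists l => y [/negP yl xy]; apply: yl.
  by have : Defs.cluster (config A t) x y by []; rewrite hl.
move=> [l hl]; apply: (@sub_finite_set _ _ [set` l]); last exact: finite_seq.
move=> y xy /=; apply: contrapT => /negP yl; exact: (hl y).
Qed.

Lemma measurable_origin_cluster_infinite : measurable (origin_cluster_infinite A).
Proof. exact: measurable_infinite_cluster. Qed.

Lemma measurable_infinite_cluster_exists : measurable (infinite_cluster_exists A).
Proof. by apply: measurable_exists => x; exact: measurable_infinite_cluster. Qed.

End Measurability.

(** * Union bounds over sets of closed edges *)

Section Covers.
Context (R : realType) (s : nat) (d : measure_display) (T : measurableType d).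
Variables (P : probability T R) (A : edge s -> set T) (p q : R).
Hypothesis perc : bond_percolation P A p q.
Hypotheses (p1 : p <= 1) (q1 : q <= 1).

Definition open_prob (e : edge s) : R := if is_Zedge e then p else q.

Definition all_open (F : seq (edge s)) : set T := [set t | forall e, e \in F -> A e t].
Definition all_closed (F : seq (edge s)) : set T := [set t | forall e, e \in F -> ~ A e t].

Lemma all_open_cons e F : all_open (e :: F) = A e `&` all_open F.
Proof.
apply/seteqP; split => t.
  by move=> h; split => [|e' h']; apply: h; rewrite inE ?eqxx // h' orbT.
by move=> [h h'] e'; rewrite inE => /orP[/eqP->|/h'].
Qed.

Lemma all_closed_cons e F : all_closed (e :: F) = all_closed F `\` A e.
Proof.
apply/seteqP; split => t.
  by move=> h; split => [e' h'|]; apply: h; rewrite inE ?eqxx // h' orbT.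
by move=> [h h'] e'; rewrite inE => /orP[/eqP->|/h].
Qed.

Lemma measurable_all_open F : measurable (all_open F).
Proof.
elim: F => [|e F IH]; last by rewrite all_open_cons; apply: measurableI => //; exact: perc.1.
by rewrite (_ : all_open _ = setT) //; apply/seteqP; split.
Qed.

Lemma measurable_all_closed F : measurable (all_closed F).
Proof.
elim: F => [|e F IH]; last by rewrite all_closed_cons; apply: measurableD => //; exact: perc.1.
by rewrite (_ : all_closed _ = setT) //; apply/seteqP; split.
Qed.

(** Induction on [G]: closing one more edge [e] gives P(B minus A e) = P(B) - P(B and A e), and the
    last event has [e] moved to the open list. The base case is the product formula for open
    edges. *)
Lemma prob_open_closed G F : uniq (F ++ G) ->
  P (all_open F `&` all_closed G) =
  (\prod_(e <- F) open_prob e * \prod_(e <- G) (1 - open_prob e))%:E.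
Proof.
elim: G F => [|e G IH] F.
  rewrite cats0 big_nil mulr1 => uF; rewrite (_ : all_closed _ = setT).
    by rewrite setIT; exact: perc.2.
  by apply/seteqP; split.
rewrite -cat1s uniq_catCA cat1s -cat_cons => ueFG.
have /andP[_ uFG] := ueFG.
rewrite all_closed_cons setIDA measureD; last 3 first.
- by apply: measurableI; [exact: measurable_all_open|exact: measurable_all_closed].
- exact: perc.1.
- by apply: le_lt_trans (probability_le1 _ _) (ltry _);
    apply: measurableI; [exact: measurable_all_open|exact: measurable_all_closed].
rewrite [_ `&` A e]setIC setIA -all_open_cons.
have /= -> := IH F uFG; have /= -> := IH (e :: F) ueFG.
by rewrite !big_cons -EFinB; congr EFin; ring.
Qed.

Definition weight (F : seq (edge s)) : R := \prod_(e <- F) (1 - open_prob e).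

Lemma prob_all_closed F : uniq F -> P (all_closed F) = (weight F)%:E.
Proof.
move=> uF; have := prob_open_closed F [::] uF; rewrite big_nil mul1r => <-.
by congr (P _); apply/seteqP; split => [t h|t []].
Qed.

Lemma weight_ge0 F : 0 <= weight F.
Proof. by apply: prodr_ge0 => e _; rewrite subr_ge0 /open_prob; case: ifP. Qed.

(* A union bound in which every term only asks for closed edges in [D]; such
   bounds multiply over disjoint regions, which replaces independence. *)
Definition covered (E : set T) (D : set (edge s)) (c : R) : Prop :=
  exists W : seq (seq (edge s)),
    [/\ forall F, F \in W -> uniq F /\ forall e, e \in F -> D e,
        E `<=` [set t | exists2 F, F \in W & all_closed F t] &
        \sum_(F <- W) weight F <= c].

Lemma covered_all_closed F D c : uniq F -> (forall e, e \in F -> D e) ->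
  weight F <= c -> covered (all_closed F) D c.
Proof.
move=> uF FD Fc; exists [:: F]; split; last by rewrite big_seq1.
  by move=> G; rewrite inE => /eqP ->.
by move=> t h; exists F; rewrite ?inE.
Qed.

Lemma covered_sub E E' D D' c c' : E `<=` E' -> D' `<=` D -> c' <= c ->
  covered E' D' c' -> covered E D c.
Proof.
move=> EE' DD' cc' [W [h1 h2 h3]]; exists W; split.
- by move=> F /h1[uF FD]; split => // e /FD /DD'.
- exact: subset_trans h2.
- exact: le_trans h3 cc'.
Qed.

Lemma covered_exists (I : eqType) (r : seq I) (E : I -> set T) D c :
  (forall i, i \in r -> covered (E i) D c) ->
  covered [set t | exists2 i, i \in r & E i t] D (c *+ size r).
Proof.
elim: r => [|i r IH] h; first by exists [::]; split => // [t []|]; rewrite ?big_nil.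
have [W [h1 h2 h3]] := h i (mem_head _ _).
have [W' [h1' h2' h3']] : covered [set t | exists2 i, i \in r & E i t] D (c *+ size r).
  by apply: IH => j jr; apply: h; rewrite inE jr orbT.
exists (W ++ W'); split.
- by move=> F; rewrite mem_cat => /orP[/h1|/h1'].
- move=> t [j]; rewrite inE => /orP[/eqP->/h2[F FW Ft]|jr Et].
    by exists F; rewrite // mem_cat FW.
  have [|F FW Ft] := h2' t; first by exists j.
  by exists F; rewrite // mem_cat FW orbT.
- by rewrite big_cat /= mulrS lerD.
Qed.

Lemma coveredU E E' D c c' : covered E D c -> covered E' D c' ->
  covered (E `|` E') D (c + c').
Proof.
move=> [W [h1 h2 h3]] [W' [h1' h2' h3']]; exists (W ++ W'); split.
- by move=> F; rewrite mem_cat => /orP[/h1|/h1'].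
- move=> t [/h2|/h2'] [F FW Ft]; exists F => //; rewrite mem_cat FW ?orbT //.
- by rewrite big_cat /= lerD.
Qed.

Lemma coveredI E E' D D' c c' : (forall e, D e -> ~ D' e) ->
  covered E D c -> covered E' D' c' ->
  covered (E `&` E') (D `|` D') (c * c').
Proof.
move=> DD' [W [h1 h2 h3]] [W' [h1' h2' h3']].
exists [seq F ++ F' | F <- W, F' <- W']; split.
- move=> _ /allpairsP[[F F'] [/= /h1[uF FD] /h1'[uF' FD'] ->]]; split.
    rewrite cat_uniq uF uF' andbT /=; apply/hasPn => e /FD' De.
    by apply/negP => /FD /DD'; exact.
  by move=> e; rewrite mem_cat => /orP[/FD|/FD']; [left|right].
- move=> t [/h2[F FW Ft] /h2'[F' FW' Ft']]; exists (F ++ F').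
    by apply/allpairsP; exists (F, F').
  by move=> e; rewrite mem_cat => /orP[/Ft|/Ft'].
- rewrite big_allpairs_dep /=.
  rewrite (eq_bigr (fun F => weight F * \sum_(F' <- W') weight F')); last first.
    by move=> F _; rewrite mulr_sumr; apply: eq_bigr => F' _; rewrite /weight big_cat.
  by rewrite -mulr_suml ler_pM // sumr_ge0 // => F _; exact: weight_ge0.
Qed.

(** [E] carries no measurability assumption, so the bound is stated for a measurable superset,
    namely the union of the covering events. *)
Lemma covered_prob E D c : covered E D c ->
  exists U, [/\ measurable U, E `<=` U & (P U <= c%:E)%E].
Proof.
move=> [W [h1 h2 h3]]; exists [set t | exists2 F, F \in W & all_closed F t].
suff [mU PU] : measurable [set t | exists2 F, F \in W & all_closed F t] /\
    (P [set t | exists2 F, F \in W & all_closed F t] <= (\sum_(F <- W) weight F)%:E)%E.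
  by split => //; apply: le_trans PU _; rewrite lee_fin.
elim: W h1 {h2 h3} => [|F W IH] h1.
  rewrite (_ : [set t | _] = set0); last by apply/seteqP; split => t // [].
  by rewrite big_nil measure0.
have [|mU PU] := IH; first by move=> G GW; apply: h1; rewrite inE GW orbT.
rewrite (_ : [set t | _] = all_closed F `|` [set t | exists2 F, F \in W & all_closed F t]).
  split; first by apply: measurableU => //; exact: measurable_all_closed.
  apply: le_trans (measureU2 _ _ _) _ => //; first exact: measurable_all_closed.
  rewrite big_cons EFinD leeD //.
  by have /= -> := prob_all_closed F (h1 F (mem_head _ _)).1.
apply/seteqP; split => t.
  by move=> [G]; rewrite inE => /orP[/eqP->|GW Gt]; [left|right; exists G].
by move=> [h|[G GW Gt]]; [exists F|exists G] => //; rewrite inE ?eqxx // GW orbT.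
Qed.

End Covers.

(** * Probability that a block is bad, and its consequences for percolation *)

Section Blocks.
Context (R : realType) (s : nat) (d : measure_display) (T : measurableType d).
Variables (P : probability T R) (A : edge s -> set T) (p q : R) (N : nat).
Hypothesis perc : bond_percolation P A p q.
Hypotheses (p1 : p <= 1) (q1 : q <= 1) (s0 : (0 < s)%N) (N0 : (0 < N)%N).
Hypothesis bad0 : (1 - p) *+ N + (1 - q) ^+ N <= 200^-1.

Definition bad (k : nat) (z : nat * nat) : set T :=
  [set t | ~ good s (config A t) N k z].

(** An edge is assigned to the box containing its base point, whatever its direction. Edges crossing
    between boxes thus belong to one box only, and regions of the same level are disjoint. *)
Definition region (k : nat) (z : nat * nat) : set (edge s) :=
  [set e | exists u v, [/\ e.1 = plane s u v,
                           (u %/ (N * 3 ^ k) = z.1)%N & (v %/ 3 ^ k = z.2)%N]].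

Lemma region_disjoint k z z' e : z != z' -> region k z e -> ~ region k z' e.
Proof.
move=> /eqP zz' [u [v [eu hu hv]]] [u' [v' []]].
rewrite eu => /(plane_inj _ _ _ _ _ s0)[<- <-].
by rewrite hu hv => h1 h2; apply: zz'; rewrite [z]surjective_pairing h1 h2 -surjective_pairing.
Qed.

Lemma region_sub k z c : c \in cells -> region k (sub z c) `<=` region k.+1 z.
Proof.
rewrite mem_cells => /andP[c1 c2] e [u [v [eu /= hu hv]]]; exists u, v; split => //.
  by rewrite expnSr mulnA divnMA hu mulnC divnMDl // divn_small // addn0.
by rewrite expnSr divnMA hv mulnC divnMDl // divn_small // addn0.
Qed.

(** Either one of the [N] Z-edges is closed, at cost [1 - p] each, or all [N] transversal edges are
    closed, at cost [(1 - q) ^+ N]. *)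
Lemma bad0_covered z : covered R s d T A p q (bad 0 z) (region 0 z) 200^-1.
Proof.
have reg j i : (j < N)%N -> region 0 z (plane s (z.1 * N + j) z.2, i).
  move=> jN; exists (z.1 * N + j)%N, z.2; split => //; rewrite expn0 ?divn1 //.
  by rewrite muln1 divnMDl // divn_small // addn0.
pose Zedge j : edge s := (plane s (z.1 * N + j) z.2, ord0).
pose Sedge j : edge s := (plane s (z.1 * N + j) z.2, inord 1).
apply: (covered_sub R s d T A p q _ ([set t | exists2 j, j \in iota 0 N &
    all_closed s d T A [:: Zedge j] t] `|` all_closed s d T A (map Sedge (iota 0 N)))
    _ (region 0 z) _ ((1 - p) *+ N + (1 - q) ^+ N)) => //.
- move=> t /= /not_andP[/existsNP[j /not_implyP[jN wj]]|h].
    left; exists j; first by rewrite mem_iota.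
    by move=> e; rewrite inE => /eqP -> Ae; apply: wj; apply/asboolP.
  right => e /mapP[j]; rewrite mem_iota => /= jN -> Ae; apply: h.
  by exists j => //; apply/asboolP.
- apply: coveredU.
    rewrite -[N in _ *+ N](size_iota 0); apply: covered_exists => j.
    rewrite mem_iota /= => jN; apply: covered_all_closed => //.
      by move=> e; rewrite inE => /eqP ->; exact: reg.
    by rewrite /weight big_seq1 /open_prob /is_Zedge eqxx.
  apply: covered_all_closed.
  + rewrite map_inj_uniq ?iota_uniq // => j j' [] /(plane_inj _ _ _ _ _ s0)[].
    by move=> /addnI.
  + by move=> e /mapP[j]; rewrite mem_iota => /= jN ->; exact: reg.
  + rewrite /weight big_map (eq_bigr (fun _ => 1 - q)).
      by rewrite big_const_seq count_predT size_iota iter_mulr_1.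
    by move=> j _; rewrite /open_prob /is_Zedge (negPf (inord1_neq0 s s0)).
Qed.

(** Halving at each level makes the bounds summable: the levels from [n] on contribute 2^-n / 100 in
    total. *)
Definition rate (k : nat) : R := 200^-1 / (2 ^ k)%:R.

Lemma rate_ge0 k : 0 <= rate k.
Proof. by rewrite /rate divr_ge0. Qed.

(* 72 is the number of ordered pairs of distinct subblocks. *)
Lemma rate_square k : rate k * rate k *+ 72 <= rate k.+1.
Proof.
have h0 := rate_ge0 k.
have h1 : rate k <= 200^-1.
  by rewrite /rate ler_pdivrMr ?ltr0n ?expn_gt0 // ler_peMr // ler1n expn_gt0.
have -> : rate k.+1 = rate k / 2.
  by rewrite /rate expnS natrM; field; rewrite pnatr_eq0 -lt0n expn_gt0.
(* The constant 200 is large enough because 72 / 200 is below 1 / 2. *)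
rewrite -mulr_natr; nra.
Qed.

Lemma bad_covered k z : covered R s d T A p q (bad k z) (region k z) (rate k).
Proof.
elim: k z => [|k IH] z; first by rewrite /rate expn0 divr1; exact: bad0_covered.
pose r := [seq x <- [seq (c, c') | c <- cells, c' <- cells] | x.1 != x.2].
apply: (covered_sub R s d T A p q _ [set t | exists2 x, x \in r &
  (bad k (sub z x.1) `&` bad k (sub z x.2)) t] _ (region k.+1 z) _
  (rate k * rate k *+ size r)) => //; last 1 first.
- apply: covered_exists => -[c c']; rewrite mem_filter => /andP[cc'].
  case/allpairsP=> -[a b] [/= ac bc [ea eb]]; subst a b.
  apply: (covered_sub _ _ _ _ _ _ _ _ _ _ (region k (sub z c) `|` region k (sub z c')) _ _
    (fun _ => id) _ (lexx _)); first by move=> e [|]; exact: region_sub.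
  apply: coveredI => // e; apply: region_disjoint.
  apply: contraNneq cc' => /= -[h1 h2].
  move: h1 h2 => /addnI h1 /addnI h2.
  by rewrite [c]surjective_pairing [c']surjective_pairing h1 h2.
- move=> t /= nG.
  have exb e : e \in cells -> exists c, [/\ c \in cells, c != e & bad k (sub z c) t].
    move=> ec; apply: contrapT => h; apply: nG; exists e => // c cc ce.
    by apply: contrapT => ng; apply: h; exists c.
  (* Non-goodness yields a bad subblock away from any proposed exception. Proposing an arbitrary
     cell gives [c], and proposing [c] gives a second bad subblock [c']. *)
  have [c [cc _ bc]] := exb (0, 0)%N isT.
  have [c' [cc' cn bc']] := exb c cc.
  exists (c, c') => //; rewrite mem_filter; apply/andP; split.
    by rewrite /= eq_sym.
  by apply/allpairsP; exists (c, c').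
- by rewrite (_ : size r = 72%N) //; exact: rate_square.
Qed.

(** Outside [E] some level [k >= n] is bad at the origin, so countable subadditivity bounds the
    complement by the tail sum of [rate]. *)
Lemma prob_good_tail (E : set T) n : measurable E ->
  (forall t, (forall k, (n <= k)%N -> good s (config A t) N k (0, 0)%N) -> E t) ->
  ((1 - 100^-1 / (2 ^ n)%:R)%:E <= P E)%E.
Proof.
move=> mE hE.
have /choice[U hU] : forall k, exists U, [/\ measurable U,
    bad (n + k) (0, 0)%N `<=` U & (P U <= (rate (n + k))%:E)%E].
  by move=> k; exact: (covered_prob _ _ _ _ _ _ _ _ perc _ _ _ (bad_covered _ _)).
have : (P (~` E) <= (100^-1 / (2 ^ n)%:R)%:E)%E.
  apply: le_trans (measure_sigma_subadditive P (F := U) _ _ _) _.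
  - by move=> k; have [] := hU k.
  - exact: measurableC.
  - move=> t /= nE; apply: contrapT => h; apply: nE; apply: hE => k nk.
    apply: contrapT => ng; apply: h; exists (k - n)%N => //.
    by have [_ + _] := hU (k - n)%N; apply; rewrite subnKC.
  (* With eps = 2^-n / 100, [rate (n + k)] is exactly eps / 2^(k+1). *)
  apply: le_trans (epsilon_trick0 xpredT _); last by rewrite divr_ge0.
  apply: lee_nneseries => // k _; have [_ _ h] := hU k.
  apply: le_trans h _; rewrite lee_fin le_eqVlt; apply/orP; left; apply/eqP.
  rewrite /rate expnD expnS !natrM; field.
  by rewrite !pnatr_eq0 -!lt0n !expn_gt0.
rewrite probability_setC // -(fineK (fin_num_measure P _ mE)).
by rewrite -EFinB !lee_fin; lra.
Qed.

(** Goodness from level [n] on makes the cluster of any level-[n] core vertex infinite, and the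
    failure probability 2^-n / 100 tends to 0 with [n]. *)
Lemma infinite_cluster_exists_as : P (infinite_cluster_exists A) = 1%E.
Proof.
have mE := measurable_infinite_cluster_exists s d T A perc.1.
apply/eqP; rewrite eq_le probability_le1 //=.
have lb n : ((1 - 100^-1 / (2 ^ n)%:R)%:E <= P (infinite_cluster_exists A))%E.
  apply: prob_good_tail => // t hg.
  have [x hx] := core_nonempty s _ N N0 _ _ (hg n (leqnn n)).
  by exists x; exact: (cluster_infinite _ _ _ s0 N0 _ _ hg hx).
rewrite -(fineK (fin_num_measure P _ mE)) lee_fin leNgt; apply/negP => lt1.
set r := fine _ in lt1; have r0 : 0 < 1 - r by rewrite subr_gt0.
(* This level [n] satisfies 2^n > 1 / (1 - r), so the failure bound falls below [1 - r], a
   contradiction. *)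
have := lb (Num.truncn (1 - r)^-1).
rewrite -(fineK (fin_num_measure P _ mE)) lee_fin -/r.
have : (1 - r)^-1 < (2 ^ Num.truncn (1 - r)^-1)%:R :> R.
  by apply: lt_le_trans (truncnS_gt _) _; rewrite ler_nat ltn_expl.
set m := (2 ^ _)%:R => hm.
have m0 : 0 < m by apply: lt_trans hm; rewrite invr_gt0.
have : 1 < (1 - r) * m by rewrite -ltr_pdivrMl // mulr1.
move: m m0 {hm} => m m0; move: r {lt1} r0 => r r0 h1 h2.
have : (1 - r) * m <= 100^-1 by rewrite -ler_pdivlMr //; lra.
lra.
Qed.

(** The origin always lies in the level-0 core of block [(0, 0)], so goodness from level 0 on
    suffices; its failure bound is 1 / 100. *)
Lemma origin_cluster_infinite_gt0 : (0 < P (origin_cluster_infinite A))%E.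
Proof.
apply: lt_le_trans (prob_good_tail _ 0 _ _).
- by rewrite lte_fin expn0 divr1; lra.
- exact: (measurable_origin_cluster_infinite _ _ _ _ perc.1).
- move=> t hg; apply: (cluster_infinite _ _ _ s0 N0 0 _ (fun k _ => hg k (leq0n k))).
  by exists 0%N; rewrite // origin_plane.
Qed.

End Blocks.

(** * Choice of the block length and of the constants *)

(** Division-free form of (1 - q)^n <= 1 / (1 + n q). The induction rests on (1 - q) (1 + (n + 1) q)
    <= 1 + n q. *)
Lemma bernoulli_pow (R : realType) (q : R) n : 0 <= q <= 1 ->
  (1 - q) ^+ n * (1 + q *+ n) <= 1.
Proof.
move=> /andP[q0 q1]; elim: n => [|n IH]; first by rewrite expr0 mulr0n; lra.
apply: le_trans IH; rewrite exprS [(1 - q) * _]mulrC -mulrA ler_wpM2l //.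
  by rewrite exprn_ge0 // subr_ge0.
rewrite mulrS; have : 0 <= q *+ n by rewrite mulrn_wge0.
by nra.
Qed.

(** Take [N] to be the integer part of x / (1 - p), so that N (1 - p) <= x. The lower bound on [q]
    gives N q >= 1 / x, and then (1 - q)^N <= 1 / (1 + N q) <= x. *)
Lemma block_length (R : realType) (p q x : R) : 0 < x -> x <= 1 -> 1 - x / 2 < p -> p < 1 ->
  4 / x ^+ 2 * ((1 - p) / (1 + p)) < q -> q <= 1 ->
  exists2 N, (0 < N)%N & (1 - p) *+ N + (1 - q) ^+ N <= x + x.
Proof.
move=> x0 x1 p0 p1 hq q1.
have e0 : 0 < 1 - p by rewrite subr_gt0.
have q0 : 2 * (1 - p) <= q * x ^+ 2.
  have h : (1 - p) / 2 <= (1 - p) / (1 + p) by rewrite ler_pM2l // lef_pV2 ?posrE //; lra.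
  rewrite -ler_pdivrMr ?exprn_gt0 //; apply: le_trans (ltW hq).
  rewrite (_ : 2 * (1 - p) / x ^+ 2 = 4 / x ^+ 2 * ((1 - p) / 2)); last by field; lra.
  by rewrite ler_wpM2l // divr_ge0 // sqr_ge0.
pose y := x / (1 - p).
have ye : y * (1 - p) = x by rewrite /y divfK // gt_eqF.
(* From [y >= 2] the integer part of [y] is at least y - 1 >= y / 2; this is what [p > 1 - x / 2] is
   for. *)
have y2 : 2 <= y by rewrite /y ler_pdivlMr //; lra.
have /andP[Ny yN] := truncn_itv (le_trans (ltW (ltr0n R 2)) y2).
set N := Num.truncn y in Ny yN; exists N; first by rewrite truncn_gt0; lra.
rewrite -natr1 in yN; move: N Ny yN => N Ny yN.
have h1 : (1 - p) *+ N <= x by rewrite -mulr_natr -ye mulrC ler_wpM2r // ltW.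
have h2 : 1 <= q *+ N * x.
  rewrite -(ler_pM2r x0) mul1r -mulr_natr.
  have -> : q * N%:R * x * x = N%:R * (q * x ^+ 2) by ring.
  apply: (@le_trans _ _ (N%:R * (2 * (1 - p)))); last by rewrite ler_wpM2l.
  by rewrite -[leLHS]ye mulrA ler_wpM2r //; lra.
have q00 : 0 <= q.
  by rewrite -(pmulr_lge0 _ (exprn_gt0 2 x0)); apply: le_trans q0; lra.
have h3 := bernoulli_pow R q N ltac:(lra).
have h4 : 0 <= (1 - q) ^+ N by rewrite exprn_ge0 // subr_ge0.
rewrite lerD //; move: ((1 - q) ^+ N) (q *+ N) h2 h3 h4 => a b h2 h3 h4.
apply: (@le_trans _ _ (a * (b * x))); first by rewrite ler_peMr.
by rewrite mulrA ler_piMl //; lra.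
Qed.

Theorem theorem2 (R : realType) (s : nat) (hs : (2 <= s)%N) :
  exists (alpha p0 : R), 0 < alpha /\ p0 < 1 /\
  forall p q : R, p0 < p -> p < 1 -> alpha * ((1 - p) / (1 + p)) < q -> q <= 1 ->
  forall (d : measure_display) (T : measurableType d) (P : probability T R)
    (A : edge s -> set T),
    bond_percolation P A p q ->
    (measurable (infinite_cluster_exists A) /\
       P (infinite_cluster_exists A) = 1%E) /\
    (measurable (origin_cluster_infinite A) /\
       (0 < P (origin_cluster_infinite A))%E).
Proof.
(* These are the constants of [block_length] at x = 1 / 400, whose bound x + x is the required 1 /
   200. *)
exists (4 / 400^-1 ^+ 2), (1 - 400^-1 / 2).
have x0 : 0 < 400^-1 :> R by rewrite invr_gt0 ltr0n.
have x1 : 400^-1 <= 1 :> R by rewrite invf_le1 ?ltr0n // ler1n.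
split; first by rewrite divr_gt0 ?exprn_gt0.
split; first by rewrite gtrBl divr_gt0.
move=> p q p0 p1 hq q1 d T P A perc.
have [N N0 bad0] := block_length R p q _ x0 x1 p0 p1 hq q1.
have {}bad0 : (1 - p) *+ N + (1 - q) ^+ N <= 200^-1 by apply: le_trans bad0 _; lra.
have s0 : (0 < s)%N := ltnW hs.
split; split.
- exact: (measurable_infinite_cluster_exists _ _ _ _ perc.1).
- exact: (infinite_cluster_exists_as _ _ _ _ _ _ p q N perc (ltW p1) q1 s0 N0 bad0).
- exact: (measurable_origin_cluster_infinite _ _ _ _ perc.1).
- exact: (origin_cluster_infinite_gt0 _ _ _ _ _ _ p q N perc (ltW p1) q1 s0 N0 bad0).
Qed.
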